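(* Let $n>1$ be an integer. The set $\{N\in\mathcal{G}_n : \mathbb{F}_n/N \text{ has intermediate growth}\}$ is $\mathbf{\Pi}^0_2$-complete.
   Context: $\mathbb{F}_n$ is the free group on $\gamma_1,\dots,\gamma_n$. $\mathcal{G}_n$ denotes the set of normal subgroups $N\trianglelefteq\mathbb{F}_n$, viewed as a subset of $\{0,1\}^{\mathbb{F}_n}$ with the subspace topology of the product of discrete topologies; it is a compact zero-dimensional Polish space. For $N\in\mathcal{G}_n$, the growth function $\Gamma_N(x)$ ($x\in\mathbb{N}^+$) is the number of elements of $\mathbb{F}_n/N$ of word length at most $x$ with respect to the generators $\gamma_1N,\dots,\gamma_nN$. $\mathbb{F}_n/N$ has exponential growth if there is a real $a>1$ with $\Gamma_N(x)\ge a^x$ for all $x$; it has polynomial growth if there are $C,d>0$ with $\Gamma_N(x)\le Cx^d$ for all $x$; it has intermediate growth if it has neither polynomial nor exponential growth. Borel classes: $\mathbf{\Sigma}^0_1$ = open sets, $\mathbf{\Pi}^0_\alpha$ = complements of $\mathbf{\Sigma}^0_\alpha$ sets, $\mathbf{\Sigma}^0_\alpha$ ($\alpha>1$) = countable unions of sets in $\bigcup_{\beta<\alpha}\mathbf{\Pi}^0_\beta$. For $\mathbf{\Gamma}$ one of these classes, $A\subseteq X$ is $\mathbf{\Gamma}$-complete if $A\in\mathbf{\Gamma}$ and for every zero-dimensional Polish space $Y$ and every $B\subseteq Y$ in $\mathbf{\Gamma}$ there is a continuous $f:Y\to X$ with $f^{-1}[A]=B$. *)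

(* Defs.v *)
From Stdlib Require Import Reals.
From mathcomp Require Import all_boot.

Set Implicit Arguments.
Unset Strict Implicit.
Unset Printing Implicit Defensive.

(* A letter (i, b) stands for gamma_i if b = false and gamma_i^{-1} if b = true. *)
Notation letter n := ('I_n * bool)%type.

Definition cancels {n} (x y : letter n) : bool := (x.1 == y.1) && (x.2 != y.2).

Fixpoint reducedb {n} (w : seq (letter n)) : bool :=
  match w with
  | x :: ((y :: _) as t) => ~~ cancels x y && reducedb t
  | _ => true
  end.

Definition push {n} (x : letter n) (s : seq (letter n)) : seq (letter n) :=
  match s with
  | y :: s' => if cancels x y then s' else x :: s
  | [::] => [:: x]
  end.

Definition reduce {n} (w : seq (letter n)) : seq (letter n) := foldr push [::] w.

Lemma push_reduced n (x : letter n) s : reducedb s -> reducedb (push x s).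
Proof.
case: s => [|y s] //= H. case: ifP => C.
- by move: H; case: s => //= z t /andP [].
- by rewrite /= C H.
Qed.

Lemma reduce_reduced n (w : seq (letter n)) : reducedb (reduce w).
Proof. by elim: w => //= x w IH; apply: push_reduced. Qed.

Definition FG (n : nat) := {w : seq (letter n) | reducedb w}.

Definition FGofword {n} (w : seq (letter n)) : FG n :=
  exist _ (reduce w) (reduce_reduced w).

Definition FGone {n} : FG n := FGofword [::].
Definition FGmul {n} (u v : FG n) : FG n := FGofword (proj1_sig u ++ proj1_sig v).
Definition flip {n} (x : letter n) : letter n := (x.1, ~~ x.2).
Definition FGinv {n} (u : FG n) : FG n := FGofword (rev (map flip (proj1_sig u))).

Definition is_normal_subgroup {n} (N : FG n -> bool) : Prop :=
  N FGone /\
  (forall u v, N u -> N v -> N (FGmul u v)) /\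
  (forall u, N u -> N (FGinv u)) /\
  (forall g u, N u -> N (FGmul (FGmul (FGinv g) u) g)).

Definition Gn (n : nat) := {N : FG n -> bool | is_normal_subgroup N}.

Fixpoint words_of_length (n k : nat) : seq (seq (letter n)) :=
  match k with
  | 0 => [:: [::]]
  | k'.+1 => [seq a :: w | a <- enum {: letter n}, w <- words_of_length n k']
  end.

(* all elements of F_n of word length at most x (with repetitions) *)
Definition ball (n x : nat) : seq (FG n) :=
  [seq FGofword w | w <- flatten [seq words_of_length n k | k <- iota 0 x.+1]].

Fixpoint count_classes {T} (e : T -> T -> bool) (l : seq T) : nat :=
  match l with
  | [::] => 0
  | a :: l' => (if has (e a) l' then 0 else 1) + count_classes e l'
  end.

(* Gamma_N(x): number of cosets gN (g N = h N iff g^{-1} h in N)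
   containing an element of word length <= x *)
Definition growth {n} (N : FG n -> bool) (x : nat) : nat :=
  count_classes (fun u v => N (FGmul (FGinv u) v)) (ball n x).

Definition exponential_growth {n} (N : FG n -> bool) : Prop :=
  exists a : R, Rlt 1 a /\
    forall x : nat, (0 < x)%N -> Rle (pow a x) (INR (growth N x)).

Definition polynomial_growth {n} (N : FG n -> bool) : Prop :=
  exists C d : R, Rlt 0 C /\ Rlt 0 d /\
    forall x : nat, (0 < x)%N -> Rle (INR (growth N x)) (Rmult C (Rpower (INR x) d)).

Definition intermediate_growth {n} (N : FG n -> bool) : Prop :=
  ~ polynomial_growth N /\ ~ exponential_growth N.

Definition closed_in {X : Type} (opens : (X -> Prop) -> Prop) (C : X -> Prop) : Prop :=
  opens (fun x => ~ C x).

Definition Sigma02 {X : Type} (opens : (X -> Prop) -> Prop) (A : X -> Prop) : Prop :=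
  exists F : nat -> X -> Prop, (forall k, closed_in opens (F k)) /\
    forall x, A x <-> exists k, F k x.

Definition Pi02 {X : Type} (opens : (X -> Prop) -> Prop) (A : X -> Prop) : Prop :=
  exists B, Sigma02 opens B /\ forall x, A x <-> ~ B x.

Definition continuous {Y X : Type} (opensY : (Y -> Prop) -> Prop)
  (opensX : (X -> Prop) -> Prop) (f : Y -> X) : Prop :=
  forall U, opensX U -> opensY (fun y => U (f y)).

Definition product_open {T : Type} (O : (T -> bool) -> Prop) : Prop :=
  forall x, O x -> exists s : seq T,
    forall y, (forall t, List.In t s -> y t = x t) -> O y.

Definition Gn_open {n} (A : Gn n -> Prop) : Prop :=
  exists O, product_open O /\ forall N : Gn n, A N <-> O (proj1_sig N).

Definition is_metric {Y : Type} (d : Y -> Y -> R) : Prop :=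
  (forall x y, Rle 0 (d x y)) /\
  (forall x y, d x y = R0 <-> x = y) /\
  (forall x y, d x y = d y x) /\
  (forall x y z, Rle (d x z) (Rplus (d x y) (d y z))).

Definition metric_open {Y : Type} (d : Y -> Y -> R) (U : Y -> Prop) : Prop :=
  forall y, U y -> exists eps, Rlt 0 eps /\ forall z, Rlt (d y z) eps -> U z.

Definition metric_complete {Y : Type} (d : Y -> Y -> R) : Prop :=
  forall u : nat -> Y,
    (forall eps, Rlt 0 eps -> exists N, forall m k,
        (N <= m)%N -> (N <= k)%N -> Rlt (d (u m) (u k)) eps) ->
    exists l, forall eps, Rlt 0 eps -> exists N, forall m,
        (N <= m)%N -> Rlt (d (u m) l) eps.

(* countable dense subset (enumerated with possible gaps, allowing Y empty) *)
Definition metric_separable {Y : Type} (d : Y -> Y -> R) : Prop :=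
  exists D : nat -> option Y, forall y eps, Rlt 0 eps ->
    exists k z, D k = Some z /\ Rlt (d y z) eps.

Definition zero_dimensional {Y : Type} (opens : (Y -> Prop) -> Prop) : Prop :=
  forall U y, opens U -> U y ->
    exists V, opens V /\ closed_in opens V /\ V y /\ forall z, V z -> U z.

Definition zero_dim_polish {Y : Type} (d : Y -> Y -> R) : Prop :=
  is_metric d /\ metric_complete d /\ metric_separable d /\
  zero_dimensional (metric_open d).

Definition Pi02_complete {X : Type} (opensX : (X -> Prop) -> Prop) (A : X -> Prop) : Prop :=
  Pi02 opensX A /\
  forall (Y : Type) (d : Y -> Y -> R), zero_dim_polish d ->
    forall B : Y -> Prop, Pi02 (metric_open d) B ->
      exists f : Y -> X, continuous (metric_open d) opensX f /\
        forall y, B y <-> A (f y).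

(* Main.v *)
Require Import Defs.
From Stdlib Require Import Reals Lra ClassicalEpsilon.
From HB Require Import structures.
From mathcomp Require Import all_boot all_algebra zify.

(** Truncating the recursion of Grigorchuk's group at depth [k], with [Z/2 * (Z/2)^2] at the bottom,
    gives groups [K_0 ->> K_1 ->> ...] of exponential growth whose growth rates tend to 1, because
    passing to sections contracts a suitable weight by 5/6.  Each [K_k] is residually finite.
    Given a counter that may increase by one at any time, keep [K_k] while the counter equals [k];
    when it increases, replace [K_k] by the diagonal product of [K_(k+1)] with a finite quotient of
    [K_k] that is faithful on a ball so large that the change is invisible at the current scale.
    If the counter stops, the limit maps onto some [K_k] and has exponential growth.  If it is
    unbounded, the limit is, up to a finite factor, a quotient of every [K_k], so its growth is
    subexponential, while large balls of it map onto balls of every [K_k], so its growth is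
    superpolynomial.  A [Pi^0_2] set is the set of points at which a continuously varying counter
    is unbounded, and [(a, b, c, d)] together with a 4-cycle of the coordinates turns the four
    generators into two. *)

Set Implicit Arguments.
Unset Strict Implicit.
Unset Printing Implicit Defensive.

(** * Normal forms in the free product [Z/2 * (Z/2)^2] *)

Inductive gen := Ga | Gb | Gc | Gd.

Definition gen_code (x : gen) : bool * bool :=
  match x with
  | Ga => (false, false) | Gb => (false, true)
  | Gc => (true, false) | Gd => (true, true)
  end.

Definition gen_decode (p : bool * bool) : gen :=
  match p with
  | (false, false) => Ga | (false, true) => Gb
  | (true, false) => Gc | (true, true) => Gd
  end.

Lemma gen_codeK : cancel gen_code gen_decode.
Proof. by case. Qed.

HB.instance Definition _ := Finite.copy gen (can_type gen_codeK).

Lemma card_gen : #|{: gen}| = 4.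
Proof.
rewrite -[4](_ : #|{: bool * bool}| = 4); last by rewrite card_prod card_bool.
apply: (bij_eq_card (f := gen_code)); exists gen_decode; first exact: gen_codeK.
by case=> [[] []].
Qed.

Definition is_a (x : gen) : bool := if x is Ga then true else false.

Definition same_factor (x y : gen) : bool := is_a x == is_a y.

(* Product of two letters of the same free factor of [Z/2 * (Z/2)^2]. *)
Definition merge_gen (x y : gen) : seq gen :=
  match x, y with
  | Gb, Gc | Gc, Gb => [:: Gd]
  | Gb, Gd | Gd, Gb => [:: Gc]
  | Gc, Gd | Gd, Gc => [:: Gb]
  | _, _ => [::]
  end.

Definition gpush (x : gen) (s : seq gen) : seq gen :=
  if s is y :: t then if same_factor x y then merge_gen x y ++ t else x :: s
  else [:: x].

Definition nf (w : seq gen) : seq gen := foldr gpush [::] w.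

Fixpoint alternating (s : seq gen) : bool :=
  if s is x :: t then (if t is y :: _ then ~~ same_factor x y else true) && alternating t
  else true.

Lemma gpush_alternating x s : alternating s -> alternating (gpush x s).
Proof.
case: s => [|y s] //= /andP[H A].
case: ifP => [|/negbT C] /=; last by rewrite C H A.
by case: x; case: y H => //=; case: s A => //= -[] t A.
Qed.

Lemma foldr_gpush_alternating w s : alternating s -> alternating (foldr gpush s w).
Proof. by move=> A; elim: w => //= x w IH; apply: gpush_alternating. Qed.

Lemma nf_alternating w : alternating (nf w).
Proof. exact: foldr_gpush_alternating. Qed.

(** Van der Waerden's trick: letters act on alternating words and the action respects the relations
    of both factors, so no confluence argument is required. *)
Lemma gpush_gpush x y s : alternating s -> same_factor x y ->
  gpush x (gpush y s) = foldr gpush s (merge_gen x y).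
Proof.
case: s => [|z s] /=; first by case: x; case: y.
by case/andP=> H A; case: x; case: y => //= _; case: z H => //=; case: s A => //= -[].
Qed.

Lemma gpush_alternating_cons x s : alternating (x :: s) -> gpush x s = x :: s.
Proof. by case: s => [|y s] //= /andP[/negbTE ->]. Qed.

Lemma nf_id s : alternating s -> nf s = s.
Proof.
elim: s => // x s IH A; rewrite /= -/(nf s) IH; last by case/andP: A.
exact: gpush_alternating_cons.
Qed.

Lemma foldr_gpush_nf w s : alternating s -> foldr gpush s (nf w) = foldr gpush s w.
Proof.
move=> A; elim: w => //= x w; rewrite -/(nf w); move: (nf_alternating w).
case: (nf w) => [|y t] Ant /= <- //.
case: ifP => [C|_] //; rewrite foldr_cat gpush_gpush //.
exact: foldr_gpush_alternating.
Qed.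

Lemma gpushK x s : alternating s -> gpush x (gpush x s) = s.
Proof. by move=> A; rewrite gpush_gpush // ?/same_factor //; case: x. Qed.

Lemma foldr_gpush_rev w s : alternating s ->
  foldr gpush (foldr gpush s w) (rev w) = s.
Proof.
move=> A; elim: w => //= x w IH.
by rewrite rev_cons -cats1 foldr_cat /= gpushK //; apply: foldr_gpush_alternating.
Qed.

Lemma size_gpush x s : size (gpush x s) <= (size s).+1.
Proof.
case: s => [|y s] //=; case: ifP => //= _; rewrite size_cat.
by case: x; case: y => /=; lia.
Qed.

Lemma size_nf w : size (nf w) <= size w.
Proof. by elim: w => //= x w IH; apply: leq_trans (size_gpush _ _) _. Qed.

(** * Quotients of the free product, given by their trivial words *)

(* [P] is the set of words trivial in some quotient of [Z/2 * (Z/2)^2]. *)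
Record relator_set (P : seq gen -> bool) : Prop := RelatorSet {
  relator_nil : P [::];
  relator_del : forall u v w, P v -> P (u ++ v ++ w) = P (u ++ w);
  relator_merge : forall u x y w, same_factor x y ->
    P (u ++ x :: y :: w) = P (u ++ merge_gen x y ++ w) }.

(** [rev u] represents the inverse of [u], because all four generators are involutions. *)
Definition equal_mod (P : seq gen -> bool) (u v : seq gen) : bool := P (rev u ++ v).

Section RelatorSet.
Variables (P : seq gen -> bool) (HP : relator_set P).

Lemma relator_push u x s : P (u ++ gpush x s) = P (u ++ x :: s).
Proof. by case: s => //= y s; case: ifP => // C; rewrite relator_merge. Qed.

Lemma relator_nf u w : P (u ++ nf w) = P (u ++ w).
Proof.
elim: w u => //= x w IH u.
by rewrite -/(nf w) relator_push -cat_rcons IH cat_rcons.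
Qed.

Lemma relator_catrev u : P (u ++ rev u).
Proof.
elim: u => [|x u IH]; first exact: relator_nil HP.
rewrite rev_cons -cats1 -cat1s -catA (catA u) relator_del //=.
by rewrite -[[:: x; x]]/([::] ++ [:: x; x]) relator_merge; case: x => //; exact: relator_nil HP.
Qed.

Lemma relator_rev u : P u -> P (rev u).
Proof.
move=> Pu; have := relator_catrev u.
by rewrite -[_ ++ _]/([::] ++ u ++ rev u) relator_del.
Qed.

Lemma relator_revE u : P (rev u) = P u.
Proof. by apply/idP/idP => [/relator_rev|/relator_rev //]; rewrite revK. Qed.

Lemma equal_mod_nf u v : equal_mod P (nf u) (nf v) = equal_mod P u v.
Proof.
rewrite /equal_mod relator_nf -relator_revE rev_cat revK relator_nf.
by rewrite -relator_revE rev_cat revK.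
Qed.

End RelatorSet.

Definition free_relators (w : seq gen) : bool := nf w == [::].

Lemma free_relator_set : relator_set free_relators.
Proof.
split=> [|u v w /eqP Hv|u x y w C] //; rewrite /free_relators /nf !foldr_cat.
- by rewrite -(foldr_gpush_nf v) ?nf_alternating // Hv.
- by rewrite /= gpush_gpush // nf_alternating.
Qed.

Lemma free_relators_min P w : relator_set P -> free_relators w -> P w.
Proof.
move=> HP /eqP Hw; have := relator_nf HP [::] w; rewrite Hw /= => <-.
exact: relator_nil HP.
Qed.

Lemma equal_mod_free u v : equal_mod free_relators u v = (nf u == nf v).
Proof.
apply/eqP/eqP => [H|H].
- have: foldr gpush (nf (rev u ++ v)) u = nf u by rewrite H.
  rewrite /nf foldr_cat -{2}(revK u) foldr_gpush_rev //.
  exact: nf_alternating.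
- by rewrite /nf foldr_cat -/(nf v) -H foldr_gpush_rev.
Qed.

(** * Residual finiteness of the free product *)

(* Action on reduced words, truncated to fix a word when it would become longer than [r]. *)
Definition bpush r (x : gen) (s : r.-bseq gen) : r.-bseq gen :=
  insubd s (gpush x s).

Lemma val_bpush r x (s : r.-bseq gen) :
  val (bpush x s) = if size (gpush x s) <= r then gpush x s else s.
Proof. by rewrite /bpush val_insubd. Qed.

Definition finite_relators r (w : seq gen) : bool :=
  [forall s : r.-bseq gen, alternating s ==> (foldr (@bpush r) s w == s)].

Lemma bpush_alternating r x (s : r.-bseq gen) : alternating s -> alternating (bpush x s).
Proof. by move=> A; rewrite val_bpush; case: ifP => // _; apply: gpush_alternating. Qed.

Lemma foldr_bpush_alternating r w (s : r.-bseq gen) :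
  alternating s -> alternating (foldr (@bpush r) s w).
Proof. by move=> A; elim: w => //= x w IH; apply: bpush_alternating. Qed.

(** An orbit of one free factor on alternating words is a word together with its one-letter
    extensions. Among the words of length at most [r] it survives whole, or as its shortest word
    alone, which is then fixed, or not at all. *)
Lemma bpush_bpush r x y (s : r.-bseq gen) : alternating s -> same_factor x y ->
  bpush x (bpush y s) = foldr (@bpush r) s (merge_gen x y).
Proof.
move=> A C; apply: val_inj.
have ->: val (foldr (@bpush r) s (merge_gen x y)) =
    if size (foldr gpush s (merge_gen x y)) <= r then foldr gpush s (merge_gen x y) else s.
  have: size (merge_gen x y) <= 1 by case: x C; case: y.
  case: (merge_gen x y) => [|z [|? ?]] //= _; first by rewrite size_bseq.
  exact: val_bpush.
rewrite !val_bpush; move: (size_bseq s) A; move: (bseqval s) => {s} [|z s] Hs /=.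
  by case: r Hs => [|r] _; case: x C; case: y.
case/andP=> H _; case: x C; case: y => // _; case: z H Hs; case: s => [|[] s] //=;
  move=> _; rewrite ?ltnS => Hs; repeat (case: ifP => //=); rewrite ?ltnS; lia.
Qed.

Lemma finite_relator_set r : relator_set (finite_relators r).
Proof.
split=> [|u v w /forallP Hv|u x y w C].
- by apply/forallP=> s; rewrite eqxx implybT.
- apply: eq_forallb => s; case A: (alternating s) => //=; rewrite !foldr_cat.
  have /implyP Hs := Hv (foldr (@bpush r) s w).
  by rewrite (eqP (Hs _)) // foldr_bpush_alternating.
- apply: eq_forallb => s; case A: (alternating s) => //=.
  by rewrite !foldr_cat /= bpush_bpush // foldr_bpush_alternating.
Qed.

Lemma foldr_bpush_rev r w (s : r.-bseq gen) : alternating s ->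
  foldr (@bpush r) (foldr (@bpush r) s w) (rev w) = s.
Proof.
move=> A; elim: w => //= x w IH; rewrite rev_cons -cats1 foldr_cat /= bpush_bpush.
- by case: x.
- exact: foldr_bpush_alternating.
- exact: eqxx.
Qed.

Lemma foldr_bpush_short r w : size w <= r ->
  val (foldr (@bpush r) [bseq] w) = nf w.
Proof.
elim: w => //= x w IH Hw; rewrite val_bpush IH ?(ltnW Hw) // -/(nf w).
by rewrite (leq_trans (size_gpush _ _)) // (leq_ltn_trans (size_nf w)).
Qed.

(** Acting on the empty word, a word of length at most [r] never meets the truncation and spells out
    its normal form. *)
Lemma finite_relators_short r w : size w <= r ->
  finite_relators r w -> free_relators w.
Proof.
move=> Hw /forallP /(_ [bseq]) /eqP H.
by rewrite /free_relators -(foldr_bpush_short Hw) H.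
Qed.

Definition finite_index (P : seq gen -> bool) : Prop :=
  exists (T : finType) (l : seq gen -> T), forall u v, l u = l v -> equal_mod P u v.

Lemma finite_relators_index r : finite_index (finite_relators r).
Proof.
exists {ffun r.-bseq gen -> r.-bseq gen}, (fun w => [ffun s => foldr (@bpush r) s w]).
move=> u v /ffunP H; apply/forallP=> s; apply/implyP=> A.
by move: (H s); rewrite !ffunE foldr_cat => <-; rewrite foldr_bpush_rev.
Qed.

(** * Grigorchuk's recursion and the groups [K_k] *)

Definition parity (w : seq gen) : bool := odd (count is_a w).

(* The decomposition [a = swap, b = (a, c), c = (a, d), d = (1, b)] of Grigorchuk's generators. *)
Definition section_gen (i : bool) (x : gen) : seq gen :=
  match x, i with
  | Ga, _ | Gd, false => [::]
  | Gb, false | Gc, false => [:: Ga]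
  | Gb, true => [:: Gc]
  | Gc, true => [:: Gd]
  | Gd, true => [:: Gb]
  end.

Fixpoint section (i : bool) (w : seq gen) : seq gen :=
  if w is x :: t then section_gen i x ++ section (i (+) is_a x) t else [::].

(** The kernel of the map to the wreath product of the quotient by [P] with [Z/2]. *)
Definition extend (P : seq gen -> bool) (w : seq gen) : bool :=
  [&& ~~ parity w, P (section false w) & P (section true w)].

Lemma parity_cat u v : parity (u ++ v) = parity u (+) parity v.
Proof. by rewrite /parity count_cat oddD. Qed.

Lemma parity_cons x w : parity (x :: w) = is_a x (+) parity w.
Proof. by rewrite -cat1s parity_cat; case: x. Qed.

Lemma parity_rev u : parity (rev u) = parity u.
Proof. by rewrite /parity count_rev. Qed.

Lemma section_cat i u v : section i (u ++ v) = section i u ++ section (i (+) parity u) v.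
Proof.
elim: u i => [|x u IH] i /=; first by rewrite addbF.
by rewrite IH catA parity_cons addbA.
Qed.

Lemma section_rev i u : section i (rev u) = rev (section (i (+) parity u) u).
Proof.
elim: u i => //= x u IH i; rewrite rev_cons -cats1 section_cat IH rev_cat parity_rev /= cats0.
by rewrite parity_cons addbA (addbAC i) -addbA; case: x; case: i; case: (parity u).
Qed.

Lemma size_section i w : size (section i w) <= size w.
Proof.
elim: w i => //= x w IH i; rewrite size_cat; have := IH (i (+) is_a x).
by case: x; case: i => /=; lia.
Qed.

Lemma extend_allP (P : seq gen -> bool) w :
  reflect (~~ parity w /\ forall i, P (section i w)) (extend P w).
Proof.
by apply: (iffP and3P) => [[H0 H1 H2]|[H0 H]]; split=> // -[].
Qed.

Lemma extend_mono (P Q : seq gen -> bool) :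
  (forall w, P w -> Q w) -> forall w, extend P w -> extend Q w.
Proof. by move=> PQ w /and3P[H0 /PQ H1 /PQ H2]; apply/and3P. Qed.

(** The letters [b, c, d] go to [a, a, 1] in one coordinate and to [c, d, b] in the other, and both
    assignments respect the multiplication of [(Z/2)^2]. *)
Lemma section_merge i x y : same_factor x y ->
  section i (merge_gen x y) = section i [:: x; y] \/
  exists x' y', [/\ same_factor x' y', section i [:: x; y] = [:: x'; y']
    & section i (merge_gen x y) = merge_gen x' y'].
Proof.
pose z := nth Ga (section i [:: x; y]).
by case: x @z; case: y; case: i => // z _; (by left) || (right; exists (z 0), (z 1)).
Qed.

Lemma extend_relator_set P : relator_set P -> relator_set (extend P).
Proof.
move=> HP; split=> [|u v w /extend_allP [H0 Hv]|u x y w C].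
- by rewrite /extend /= !relator_nil.
- rewrite /extend !parity_cat (negbTE H0) !section_cat (negbTE H0) !addbF.
  by rewrite !(relator_del HP) // Hv.
- have Hp: parity (merge_gen x y) = parity [:: x; y] by case: x C; case: y.
  have Hs i u' w' : P (u' ++ section i [:: x; y] ++ w') = P (u' ++ section i (merge_gen x y) ++ w').
    case: (section_merge i C) => [-> //|[x' [y' [C' -> ->]]]].
    exact: relator_merge.
  rewrite -[x :: y :: w]/([:: x; y] ++ w) /extend !parity_cat Hp; congr (_ && (_ && _));
  by rewrite !section_cat Hs Hp.
Qed.

Lemma equal_mod_extend (P : seq gen -> bool) u v :
  reflect (parity u = parity v /\ forall i, equal_mod P (section i u) (section i v))
    (equal_mod (extend P) u v).
Proof.
rewrite /equal_mod; apply: (iffP (extend_allP _ _)); rewrite parity_cat parity_rev.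
- case=> H0 H; split; first by case: (parity u) (parity v) H0 => [] [].
  (* Shifting the index by [parity u] undoes the swap of coordinates caused by [rev u]. *)
  by move=> i; have := H (i (+) parity u);
    rewrite section_cat section_rev parity_rev -addbA addbb addbF.
- case=> -> H; split; first by rewrite addbb.
  by move=> i; rewrite section_cat section_rev parity_rev.
Qed.

Lemma extend_finite_index P : finite_index P -> finite_index (extend P).
Proof.
case=> T [l H]; exists (bool * (T * T))%type.
exists (fun w => (parity w, (l (section false w), l (section true w)))) => u v [Hp H0 H1].
by apply/equal_mod_extend; split=> // -[]; apply: H.
Qed.

(** [tower k] defines [K_k]; [finite_tower k r] puts at the bottom a finite quotient in which no
    nontrivial word of length at most [r] dies. *)
Definition tower k : seq gen -> bool := iter k extend free_relators.
Definition finite_tower k r : seq gen -> bool := iter k extend (finite_relators r).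

Lemma iter_extend_relator_set k P : relator_set P -> relator_set (iter k extend P).
Proof. by move=> HP; elim: k => //= k; apply: extend_relator_set. Qed.

Lemma tower_relator_set k : relator_set (tower k).
Proof. exact/iter_extend_relator_set/free_relator_set. Qed.

Lemma finite_tower_relator_set k r : relator_set (finite_tower k r).
Proof. exact/iter_extend_relator_set/finite_relator_set. Qed.

Lemma finite_tower_index k r : finite_index (finite_tower k r).
Proof.
by elim: k => [|k IH]; [apply: finite_relators_index | exact: (extend_finite_index IH)].
Qed.

Lemma iter_extend_mono k (P Q : seq gen -> bool) : (forall w, P w -> Q w) ->
  forall w, iter k extend P w -> iter k extend Q w.
Proof. by move=> PQ; elim: k => //= k IH; apply: extend_mono. Qed.

(** The two recursions differ only at the bottom, where the free product maps onto its own
    extension. *)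
Lemma towerS k w : tower k w -> tower k.+1 w.
Proof.
rewrite /tower iterSr; apply: iter_extend_mono => {}w.
exact/free_relators_min/extend_relator_set/free_relator_set.
Qed.

Lemma tower_finite k r w : tower k w -> finite_tower k r w.
Proof. by apply: iter_extend_mono => {}w; apply/free_relators_min/finite_relator_set. Qed.

(** Sections never lengthen a word, so the bottom level only sees words of length at most [r]. *)
Lemma finite_tower_short k r w : size w <= r -> finite_tower k r w -> tower k w.
Proof.
elim: k w => [|k IH] w Hw; first exact: finite_relators_short.
case/extend_allP=> H0 H; apply/extend_allP; split=> // i.
by apply: IH (H i); exact: leq_trans (size_section _ _) Hw.
Qed.

(** * Contraction of weights and short codes for the elements of [K_k] *)

(* Weights for which [b = (a, c)], [c = (a, d)], [d = (1, b)] each shrink [wt a + wt x] by a factor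
   at most 5/6, and which still satisfy the triangle inequality on [(Z/2)^2]. *)
Definition gen_weight (x : gen) : nat :=
  match x with Ga | Gb => 3 | Gc => 2 | Gd => 1 end.

Definition weight (w : seq gen) : nat := sumn (map gen_weight w).

Lemma weight_cat u v : weight (u ++ v) = weight u + weight v.
Proof. by rewrite /weight map_cat sumn_cat. Qed.

Lemma weight_gpush x s : weight (gpush x s) <= gen_weight x + weight s.
Proof.
case: s => [|y s] //=; case: ifP => // _; rewrite weight_cat /weight /=.
by case: x; case: y => /=; lia.
Qed.

Lemma weight_nf w : weight (nf w) <= weight w.
Proof.
elim: w => // x w IH; apply: leq_trans (weight_gpush _ _) _.
by rewrite /weight /= leq_add2l.
Qed.

Lemma size_le_weight w : size w <= weight w.
Proof. by elim: w => // x w; rewrite /weight /=; case: x => /=; lia. Qed.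

Lemma weight_le_size w : weight w <= 3 * size w.
Proof. by elim: w => // x w; rewrite /weight /=; case: x => /=; lia. Qed.

Lemma weight_sections w : alternating w ->
  6 * (weight (section false w) + weight (section true w)) <= 5 * weight w + 15.
Proof.
(* The slack [15 = 5 * 3] is the contribution of one [a]: a letter other than [a] borrows it, and an
   [a] in front of that letter repays it. The default head [Ga] gives the empty word no slack. *)
have H: forall i, alternating w -> 6 * (weight (section i w) + weight (section (~~ i) w)) <=
    5 * weight w + 15 * ~~ (is_a (head Ga w)).
  elim: w => [|x w IH] i // /andP[Hh A].
  have {IH} := IH (i (+) is_a x) A; rewrite [section i _]/= [section (~~ i) _]/= addNb.
  move: (section _ w) (section _ w) => s0 s1; rewrite !weight_cat [weight (x :: w)]/=.
  rewrite -/(weight w) [head _ _]/=.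
  have {Hh A}: ~~ is_a x -> is_a (head Ga w) by case: x Hh; case: (w) => [|[]].
  case: x => /= Hh; first by case: (is_a _); rewrite /weight /=; lia.
  1-3: by rewrite Hh //; case: i; rewrite /weight /=; lia.
move=> A; apply: leq_trans (H false A) _; rewrite leq_add2l.
by case: (~~ _).
Qed.

(** [None] ends a leaf, [inl] carries a parity, [inr] a letter. *)
Definition code_symbol := option (bool + gen).

Lemma card_code_symbol : #|{: code_symbol}| = 7.
Proof. by rewrite card_option card_sum card_bool card_gen. Qed.

(* The portrait of an element of the [k]-th group down to level [k], written as a prefix code. *)
Fixpoint code k (w : seq gen) : seq code_symbol :=
  if k is k'.+1 then
    Some (inl (parity (nf w))) :: code k' (section false (nf w)) ++ code k' (section true (nf w))
  else rcons (map (Some \o inr) (nf w)) None.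

(** The tails [s] and [t] express the prefix property, which the induction uses to split the
    concatenated codes of the two sections. *)
Lemma code_inj_cat k u v s t :
  code k u ++ s = code k v ++ t -> equal_mod (tower k) u v /\ s = t.
Proof.
elim: k u v s t => [|k IH] u v s t /=.
  rewrite equal_mod_free; move: (nf u) (nf v) => {u v} u v.
  by elim: u v => [|x u IH] [|y v] //= [] // -> /IH [/eqP -> ->].
case=> Hp; rewrite -!catA => /IH[H0] /IH[H1 ->]; split=> //.
rewrite -equal_mod_nf; last exact: tower_relator_set k.+1.
by apply/equal_mod_extend; split=> // -[].
Qed.

Lemma code_inj k u v : code k u = code k v -> equal_mod (tower k) u v.
Proof. by move=> H; have [] := @code_inj_cat k u v [::] [::]; rewrite ?H. Qed.

Lemma size_code k : exists K, forall w, 6 ^ k * size (code k w) <= 5 ^ k * weight w + K.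
Proof.
elim: k => [|k [K IH]].
  exists 1 => w; rewrite /= size_rcons size_map !mul1n addn1 ltnS.
  exact: leq_trans (size_le_weight _) (weight_nf _).
(* The summands pay for the parity symbol, for the additive error of [weight_sections], and for the
   constant [K] of each of the two sections, scaled by 6. *)
exists (6 ^ k.+1 + 5 ^ k * 15 + 12 * K) => w; rewrite [code _ _]/= [size _]/= size_cat.
have H0 := IH (section false (nf w)); have H1 := IH (section true (nf w)).
have := weight_sections (nf_alternating w); have := weight_nf w.
rewrite -(leq_pmul2l (m := 5 * 5 ^ k)) ?muln_gt0 ?expn_gt0 // => H2.
rewrite -(leq_pmul2l (m := 5 ^ k)) ?expn_gt0 // => H3.
rewrite !expnS; move: H0 H1 H2 H3; nia.
Qed.

(** * Exponentially many elements in [K_k] *)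

(* A preimage of [x] under the section at [true]: [aba = (c, a)], [d = (1, b)], [b = (a, c)],
   [c = (a, d)]. *)
Definition unsection_gen (x : gen) : seq gen :=
  match x with Ga => [:: Ga; Gb; Ga] | Gb => [:: Gd] | Gc => [:: Gb] | Gd => [:: Gc] end.

Definition unsection (w : seq gen) : seq gen := flatten (map unsection_gen w).

Lemma section_unsection w : section true (unsection w) = w.
Proof.
elim: w => // x w IH; rewrite /unsection /= -/(unsection w) section_cat.
have -> : section true (unsection_gen x) = [:: x] by case: x.
have -> : parity (unsection_gen x) = false by case: x.
by rewrite IH.
Qed.

Lemma size_unsection w : size (unsection w) <= 3 * size w.
Proof.
elim: w => // x w IH; rewrite /unsection /= -/(unsection w) size_cat.
by case: x => /=; lia.
Qed.

Definition deep_section k : seq gen -> seq gen := iter k (section true).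
Definition deep_unsection k : seq gen -> seq gen := iter k unsection.

Lemma deep_sectionK k : cancel (deep_unsection k) (deep_section k).
Proof. by elim: k => // k IH w; rewrite /deep_section iterSr /= section_unsection; apply: IH. Qed.

Lemma size_deep_unsection k w : size (deep_unsection k w) <= 3 ^ k * size w.
Proof.
elim: k => [|k IH]; first by rewrite mul1n.
by apply: leq_trans (size_unsection _) _; rewrite expnS -mulnA leq_pmul2l.
Qed.

(** The section at the all-[true] vertex of level [k] is a label, well defined on [K_k], that takes
    every value in the free product; reaching a value costs at most a factor [3 ^ k] in length. *)
Lemma nf_deep_section k u v :
  equal_mod (tower k) u v -> nf (deep_section k u) = nf (deep_section k v).
Proof.
elim: k u v => [|k IH] u v; first by rewrite equal_mod_free => /eqP.
by rewrite /deep_section !iterSr => /equal_mod_extend [_ /(_ true) /IH].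
Qed.

(** [ab] and [ac] generate a free monoid, hence [2 ^ m] elements written with [2 * m] letters. *)
Definition ab_ac_word (l : seq bool) : seq gen :=
  flatten [seq [:: Ga; if b then Gb else Gc] | b <- l].

Lemma size_ab_ac_word l : size (ab_ac_word l) = 2 * size l.
Proof. by elim: l => //= b l IH; rewrite -/(ab_ac_word l) IH; lia. Qed.

Lemma ab_ac_word_alternating l : alternating (ab_ac_word l).
Proof. by elim: l => // b [|b' l]; case: b. Qed.

Lemma ab_ac_word_inj : injective ab_ac_word.
Proof. by elim=> [|b l IH] [|b' l'] //= [E /IH ->]; case: b b' E => [] []. Qed.

(** * From four generators to two: the wreath product with [Z/4] *)

Section Lift.
Variable n : nat.
Import GRing.Theory.
Local Open Scope ring_scope.

(* [gamma_0] acts as a 4-cycle of coordinates, [gamma_1] as [(a, b, c, d)], the rest trivially. *)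
Definition shift (x : letter n) : 'Z_4 :=
  if val x.1 == 0%N then (if x.2 then -1 else 1) else 0.

Definition gen_at (i : 'Z_4) : gen :=
  match val i with 0 => Ga | 1 => Gb | 2 => Gc | _ => Gd end%N.

(** The sign of the letter is ignored, as the emitted generators are involutions. *)
Definition emit (i : 'Z_4) (x : letter n) : seq gen :=
  if val x.1 == 1%N then [:: gen_at i] else [::].

Definition total_shift (w : seq (letter n)) : 'Z_4 := \sum_(x <- w) shift x.

Fixpoint trace (i : 'Z_4) (w : seq (letter n)) : seq gen :=
  if w is x :: t then emit i x ++ trace (i + shift x) t else [::].

Definition permutational_lift (P : seq gen -> bool) (w : seq (letter n)) : bool :=
  (total_shift w == 0) && [forall i, P (trace i w)].

Definition inv_word (w : seq (letter n)) := rev (map flip w).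

Lemma total_shift_cat u v : total_shift (u ++ v) = total_shift u + total_shift v.
Proof. by rewrite /total_shift big_cat. Qed.

Lemma trace_cat i u v : trace i (u ++ v) = trace i u ++ trace (i + total_shift u) v.
Proof.
elim: u i => [|x u IH] i; first by rewrite /total_shift big_nil addr0.
by rewrite /= IH catA /total_shift big_cons addrA.
Qed.

Lemma inv_word_cons x u : inv_word (x :: u) = inv_word u ++ [:: flip x].
Proof. by rewrite /inv_word /= rev_cons cats1. Qed.

Lemma shift_flip x : shift (flip x) = - shift x.
Proof. by rewrite /shift /=; case: ifP => _; rewrite ?oppr0 //; case: x.2; rewrite ?opprK. Qed.

Lemma total_shift_inv u : total_shift (inv_word u) = - total_shift u.
Proof.
elim: u => [|x u IH]; first by rewrite /total_shift big_nil oppr0.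
rewrite inv_word_cons total_shift_cat IH /total_shift big_seq1 big_cons shift_flip.
by rewrite opprD addrC.
Qed.

Lemma trace_inv i u : trace i (inv_word u) = rev (trace (i - total_shift u) u).
Proof.
elim: u i => // x u IH i; rewrite inv_word_cons trace_cat IH total_shift_inv /=.
have -> : i - total_shift (x :: u) = i - total_shift u - shift x.
  by rewrite /total_shift big_cons opprD addrA addrAC.
rewrite subrK rev_cat cats0; congr (_ ++ _); rewrite /emit /shift /=.
by case: ifP => //= /eqP ->; rewrite subr0.
Qed.

Lemma size_trace i w : (size (trace i w) <= size w)%N.
Proof.
elim: w i => //= x w IH i; rewrite size_cat; have := IH (i + shift x).
by rewrite /emit; case: ifP => /=; lia.
Qed.

End Lift.

(** * Normal subgroups of the free group from sets of words *)

Section WordRelators.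
Variable n : nat.
Import GRing.Theory.

(* [Q] is the set of words trivial in some quotient of the free group. *)
Record word_relator_set (Q : seq (letter n) -> bool) : Prop := WordRelatorSet {
  word_relator_nil : Q [::];
  word_relator_del : forall u v w, Q v -> Q (u ++ v ++ w) = Q (u ++ w);
  word_relator_flip : forall x, Q [:: x; flip x] }.

Section Fixed.
Variables (Q : seq (letter n) -> bool) (HQ : word_relator_set Q).

Lemma word_relator_cons_cancel u x y w : cancels x y -> Q (u ++ x :: y :: w) = Q (u ++ w).
Proof.
case: x y => [i b] [j c] /andP[/= /eqP <- H].
have -> : (i, c) = flip (i, b) by rewrite /flip /=; case: b c H => [] [].
by rewrite -[_ :: _ :: w]/([:: (i, b); flip (i, b)] ++ w) word_relator_del // word_relator_flip.
Qed.

Lemma word_relator_reduce u w v : Q (u ++ reduce w ++ v) = Q (u ++ w ++ v).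
Proof.
elim: w u => // x w IH u; rewrite /= -/(reduce w).
transitivity (Q (u ++ (x :: reduce w) ++ v)); last by rewrite /= -cat_rcons IH cat_rcons.
case: (reduce w) => //= y s; case: ifP => // C.
by rewrite [in RHS]word_relator_cons_cancel.
Qed.

Lemma word_relator_inv_cat u : Q (inv_word u ++ u).
Proof.
elim: u => [|x u IH]; first exact: word_relator_nil.
by rewrite inv_word_cons -catA word_relator_cons_cancel // /cancels /= eqxx; case: x.2.
Qed.

Lemma word_relator_inv u : Q u -> Q (inv_word u).
Proof.
move=> Hu; have := word_relator_inv_cat u; rewrite -[u in _ ++ u]cats0.
by rewrite word_relator_del // cats0.
Qed.

Lemma word_relator_normal : is_normal_subgroup (fun u : FG n => Q (proj1_sig u)).
Proof.
have R w : Q (reduce w) = Q w by have := word_relator_reduce [::] w [::]; rewrite !cats0.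
split; first exact: word_relator_nil.
split=> [u v Hu Hv|]; first by rewrite R -[_ ++ _]/([::] ++ _ ++ _) word_relator_del.
split=> [u Hu|g u Hu]; first by rewrite R word_relator_inv.
rewrite R -[_ ++ _]/([::] ++ _ ++ _) word_relator_reduce /=.
rewrite -[(_ ++ _) ++ _]/([::] ++ _) -!catA word_relator_reduce /= word_relator_del //.
exact: word_relator_inv_cat.
Qed.

Lemma word_relator_mul_inv (u v : FG n) :
  Q (proj1_sig (FGmul (FGinv u) v)) = Q (inv_word (proj1_sig u) ++ proj1_sig v).
Proof.
have R w : Q (reduce w) = Q w by have := word_relator_reduce [::] w [::]; rewrite !cats0.
by rewrite /= R; have := word_relator_reduce [::] (inv_word (proj1_sig u)) (proj1_sig v).
Qed.

End Fixed.

Lemma lift_word_relator_set P : relator_set P -> word_relator_set (@permutational_lift n P).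
Proof.

move=> HP; split=> [|u v w /andP[/eqP H0 /forallP Hv]|x].
- rewrite /permutational_lift /total_shift big_nil eqxx; apply/forallP=> i; exact: relator_nil HP.
- rewrite /permutational_lift !total_shift_cat H0 add0r; congr (_ && _); apply: eq_forallb => i.
  by rewrite !trace_cat H0 addr0 relator_del.
- rewrite /permutational_lift /total_shift !big_cons big_nil shift_flip addr0 subrr eqxx.
  apply/forallP=> i /=; rewrite cats0.
  have -> : emit (i + shift x)%R (flip x) = emit i x.
    by rewrite /emit /shift /=; case: ifP => //= /eqP ->; rewrite addr0.
  rewrite /emit; case: ifP => _ /=; last exact: relator_nil HP.
  have := @relator_merge _ HP [::] (gen_at i) (gen_at i) [::] (eqxx _); rewrite /= => ->.
  by case: (gen_at i); exact: relator_nil HP.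
Qed.

Lemma lift_inv_cat (P : seq gen -> bool) u v :
  reflect (total_shift u = total_shift v /\ forall i, equal_mod P (trace i u) (trace i v))
    (@permutational_lift n P (inv_word u ++ v)).
Proof.
rewrite /permutational_lift total_shift_cat total_shift_inv addrC subr_eq0.
apply: (iffP andP) => [[/eqP E /forallP H]|[-> H]]; split=> //.
- move=> i; have := H (i + total_shift u)%R.
  by rewrite trace_cat trace_inv total_shift_inv addrK.
- apply/forallP=> i; rewrite trace_cat trace_inv total_shift_inv; exact: H.
Qed.

End WordRelators.

(** * Bounding the growth function by labels *)

Lemma count_classes_le (S : Type) (T : eqType) (e : S -> S -> bool) (l : S -> T) (s : seq S) :
  (forall a b, l a = l b -> e a b) -> count_classes e s <= size (undup (map l s)).
Proof.
move=> H; elim: s => //= a s IH; case: (boolP (l a \in _)) => Hm /=.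
- suff -> : has (e a) s by [].
  elim: s {IH} Hm => //= b s IH; rewrite inE => /orP[/eqP/H ->|/IH ->] //; exact: orbT.
- by case: (has _ _); rewrite ?add1n ?ltnS // ltnW.
Qed.

Lemma count_classes_ge (S : Type) (T : eqType) (p : pred S) (e : S -> S -> bool) (l : S -> T)
    (s : seq S) : all p s ->
  (forall a b, p a -> p b -> e a b -> l a = l b) -> size (undup (map l s)) <= count_classes e s.
Proof.
move=> Hp H; elim: s Hp => //= a s IH /andP[Ha Hs]; case: (boolP (l a \in _)) => Hm /=.
- exact: leq_trans (IH Hs) (leq_addl _ _).
- suff -> : has (e a) s = false by rewrite ltnS IH.
  apply/negP=> He; apply: (negP Hm) => {Hm IH}; elim: s Hs He => //= b s IH /andP[Hb Hs].
  by case/orP=> [/(H _ _ Ha Hb) ->|/IH Hm]; rewrite inE ?eqxx // Hm ?orbT.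
Qed.

Lemma mem_words_of_length n (w : seq (letter n)) : w \in words_of_length n (size w).
Proof.
elim: w => //= x w IH; apply/allpairsP; exists (x, w); split=> //=.
by rewrite mem_enum.
Qed.

Lemma size_words_of_length n k (w : seq (letter n)) : w \in words_of_length n k -> size w = k.
Proof.
elim: k w => [|k IH] w /=; first by rewrite inE => /eqP ->.
by case/allpairsP=> -[x v] /= [_ /IH <- ->].
Qed.

Lemma size_push n (x : letter n) s : size (push x s) <= (size s).+1.
Proof. by case: s => //= y s; case: ifP => //= _; lia. Qed.

Lemma size_reduce n (w : seq (letter n)) : size (reduce w) <= size w.
Proof. by elim: w => //= x w IH; apply: leq_trans (size_push _ _) _. Qed.

Lemma ball_size n x : all (fun u : FG n => size (proj1_sig u) <= x) (ball n x).
Proof.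
rewrite /ball all_map; apply/allP=> w /flatten_mapP [k]; rewrite mem_iota => /andP[_ Hk].
move/size_words_of_length => Hw /=; apply: leq_trans (size_reduce _) _; lia.
Qed.

Lemma growth_le_card n (Q : seq (letter n) -> bool) (T : finType) (l : seq (letter n) -> T) x :
  word_relator_set Q ->
  (forall u v, size u <= x -> size v <= x -> l u = l v -> Q (inv_word u ++ v)) ->
  growth (fun u : FG n => Q (proj1_sig u)) x <= #|T|.
Proof.
move=> HQ H; rewrite /growth; set e := fun u v => _.
(* Relating everything outside the ball makes the hypothesis on labels unconditional without
   changing the count inside the ball. *)
pose e' (u v : FG n) := e u v || ~~ (size (proj1_sig u) <= x) || ~~ (size (proj1_sig v) <= x).
have -> : count_classes e (ball n x) = count_classes e' (ball n x).
  elim: (ball n x) (ball_size n x) => //= a s IH /andP[Ha Hs]; rewrite IH //; congr (_ + _).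
  have -> // : has (e a) s = has (e' a) s.
  by elim: s Hs {IH} => //= b s IH /andP[Hb /IH ->]; rewrite /e' Ha Hb !orbF.
apply: leq_trans (count_classes_le (l := fun u : FG n => l (proj1_sig u)) _ _) _.
- move=> u v Hl; rewrite /e' /e (word_relator_mul_inv HQ).
  by case Hu: (_ <= x); case Hv: (_ <= x); rewrite ?orbT // (H _ _ Hu Hv Hl).
- rewrite cardE; apply: uniq_leq_size; first exact: undup_uniq.
  by move=> t _; rewrite mem_enum.
Qed.

Lemma growth_ge_labels n (Q : seq (letter n) -> bool) (T : eqType) (l : seq (letter n) -> T)
    (s : seq T) x :
  word_relator_set Q ->
  (forall u v, size u <= x -> size v <= x -> Q (inv_word u ++ v) -> l u = l v) ->
  uniq s -> (forall t, t \in s -> exists2 w, size w <= x & l w = t) ->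
  size s <= growth (fun u : FG n => Q (proj1_sig u)) x.
Proof.
move=> HQ H Us Hs; rewrite /growth.
apply: leq_trans (count_classes_ge (l := fun u : FG n => l (proj1_sig u)) (ball_size n x) _).
- apply: uniq_leq_size => // t /Hs [w Hw <-]; rewrite mem_undup.
  have -> : l w = l (proj1_sig (FGofword w)).
    apply: H => //; first exact: leq_trans (size_reduce _) Hw.
    have := word_relator_reduce HQ (inv_word w) w [::]; rewrite !cats0 /= => ->.
    exact: word_relator_inv_cat.
  rewrite /ball -map_comp; apply: (map_f (fun v => l (reduce v))).
  apply/flatten_mapP; exists (size w); last exact: mem_words_of_length.
  by rewrite mem_iota add0n ltnS.
- by move=> u v Hu Hv; rewrite (word_relator_mul_inv HQ); apply: H.
Qed.

(** * Growth of the lift compared with that of [K_k] *)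

Section Spread.
Variables (n : nat) (Hn : 1 < n).
Import GRing.Theory.

(** A conjugate of [gamma_1] by a power of [gamma_0], rotated so that coordinate 0 reads exactly
    [x]. *)
Definition spread_gen (x : gen) : seq (letter n) :=
  let i := match x with Ga => 0 | Gb => 1 | Gc => 2 | Gd => 3 end in
  nseq i (Ordinal (ltnW Hn), false) ++ (Ordinal Hn, false) :: nseq i (Ordinal (ltnW Hn), true).

Definition spread (w : seq gen) : seq (letter n) := flatten (map spread_gen w).

Lemma total_shift_spread_gen x : total_shift (spread_gen x) = 0%R.
Proof. by apply: val_inj; rewrite /total_shift; case: x => /=; rewrite !big_cons big_nil. Qed.

Lemma trace_spread_gen x : trace 0%R (spread_gen x) = [:: x].
Proof. by case: x. Qed.

Lemma trace_spread w : trace 0%R (spread w) = w.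
Proof.
elim: w => // x w IH; rewrite /spread /= -/(spread w) trace_cat trace_spread_gen.
by rewrite total_shift_spread_gen addr0 IH.
Qed.

Lemma size_spread w : size (spread w) <= 7 * size w.
Proof.
elim: w => // x w IH; rewrite /spread /= -/(spread w) size_cat.
have : size (spread_gen x) <= 7 by case: x.
by lia.
Qed.

(** In [14 = 7 * 2], the 7 comes from [spread] and the 2 from [ab_ac_word]; [3 ^ k] is the cost of
    [deep_unsection]. *)
Lemma growth_ge_tower k m x (Q : seq (letter n) -> bool) : word_relator_set Q ->
  (forall u v, size u <= x -> size v <= x -> Q (inv_word u ++ v) ->
     equal_mod (tower k) (trace 0%R u) (trace 0%R v)) ->
  14 * (3 ^ k * m) <= x -> 2 ^ m <= growth (fun u : FG n => Q (proj1_sig u)) x.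
Proof.
move=> HQ H Hx.
have -> : 2 ^ m = size [seq ab_ac_word (val t) | t <- enum {: m.-tuple bool}].
  by rewrite size_map -cardE card_tuple card_bool.
apply: (growth_ge_labels (l := fun u => nf (deep_section k (trace 0%R u)))) => //.
- by move=> u v Hu Hv /(H _ _ Hu Hv) /nf_deep_section.
- by rewrite map_inj_uniq ?enum_uniq // => s t /ab_ac_word_inj /val_inj.
- move=> _ /mapP[t _ ->]; exists (spread (deep_unsection k (ab_ac_word t))).
    apply: leq_trans (size_spread _) _.
    have := size_deep_unsection k (ab_ac_word t); rewrite size_ab_ac_word size_tuple.
    by move: Hx; nia.
  by rewrite trace_spread deep_sectionK nf_id // ab_ac_word_alternating.
Qed.

End Spread.

Lemma sum_expn7 M : \sum_(i < M.+1) 7 ^ i <= 8 ^ M.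
Proof.
elim: M => [|M IH]; first by rewrite big_ord1.
rewrite big_ord_recr /=; apply: leq_trans (leq_add IH (leqnn _)) _.
have H : 7 ^ M <= 8 ^ M by case: (M) => // m; rewrite leq_exp2r.
by rewrite !expnS; lia.
Qed.

Lemma card_code_bseq M : #|{: M.-bseq code_symbol}| <= 8 ^ M.
Proof. by rewrite card_bseq card_code_symbol sum_expn7. Qed.

(** An element is determined by its total shift and, in each of four coordinates, by a finite label
    and a code. The exponent [12 = 4 * 3] counts four coordinates and the largest weight 3 of a
    letter. *)
Lemma growth_le_tower n k (F P : seq gen -> bool) : finite_index F -> relator_set P ->
  (forall w, F w -> tower k w -> P w) ->
  exists C, forall z,
    growth (fun u : FG n => permutational_lift P (proj1_sig u)) (6 ^ k * z) <=
    C * 8 ^ (12 * (5 ^ k * z)).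
Proof.
case=> T [l Hl] HP H; have [K HK] := size_code k.
exists (#|{: 'Z_4 * {ffun 'Z_4 -> T}}| * (8 ^ K) ^ 4) => z.
pose M := 3 * (5 ^ k * z) + K.
apply: leq_trans (growth_le_card
  (T := ('Z_4 * {ffun 'Z_4 -> T} * {ffun 'Z_4 -> M.-bseq code_symbol})%type)
  (l := fun u => (total_shift u, [ffun i => l (trace i u)],
     [ffun i => insubd ([bseq] : M.-bseq code_symbol) (code k (trace i u))])) _ _) _.
- exact: lift_word_relator_set.
(* Codes fit into [M] symbols on this ball, so the default of [insubd] is never taken. *)
- have Hc w i : size w <= 6 ^ k * z -> size (code k (trace (n := n) i w)) <= M.
    move=> Hw; rewrite -(leq_pmul2l (m := 6 ^ k)) ?expn_gt0 //; apply: leq_trans (HK _) _.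
    have H1 := weight_le_size (trace i w); have H2 := size_trace i w.
    have H3 : K <= 6 ^ k * K by rewrite leq_pmull // expn_gt0.
    have : weight (trace i w) <= 3 * (6 ^ k * z) by lia.
    by rewrite -(leq_pmul2l (m := 5 ^ k)) ?expn_gt0 // /M; nia.
  move=> u v Hu Hv [E1 /ffunP E2 /ffunP E3]; apply/lift_inv_cat; split=> // i.
  apply: H; first by apply: Hl; have := E2 i; rewrite !ffunE.
  apply: code_inj; have := congr1 val (E3 i).
  by rewrite !ffunE !val_insubd !Hc.
- rewrite card_prod [X in _ * X]card_ffun card_ord -mulnA leq_mul2l; apply/orP; right.
  apply: leq_trans (_ : (8 ^ M) ^ 4 <= _); first by rewrite leq_exp2r // card_code_bseq.
  rewrite /M expnD expnMn mulnC leq_mul2l -!expnM; apply/orP; right.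
  by rewrite leq_exp2l //; lia.
Qed.

(** * The limit group driven by a counter *)

Lemma finite_index_all (I : Type) (s : seq I) (b : I -> bool) (P : I -> seq gen -> bool) :
  (forall i, finite_index (P i)) -> finite_index (fun w => all (fun i => b i ==> P i w) s).
Proof.
move=> HP; elim: s => [|i s [T [l Hl]]]; first by exists unit, (fun _ => tt).
have [T' [l' Hl']] := HP i; exists (T' * T)%type, (fun w => (l' w, l w)).
move=> u v [/Hl' H1 /Hl H2]; rewrite /equal_mod /=; apply/andP; split=> //.
by apply/implyP.
Qed.

Lemma relator_set_all (I : Type) (s : seq I) (b : I -> bool) (P : I -> seq gen -> bool) Q :
  (forall i, relator_set (P i)) -> relator_set Q ->
  relator_set (fun w => all (fun i => b i ==> P i w) s && Q w).
Proof.
move=> HP HQ; split=> [|u v w|u x y w C].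
- rewrite relator_nil // andbT; elim: s => //= i s ->.
  by rewrite relator_nil ?implybT.
- case/andP=> Hs Hq; congr (_ && _); last exact: relator_del.
  elim: s Hs => //= i s IH /andP[Hi /IH ->]; case: (b i) Hi => //= Hi.
  by rewrite relator_del.
- congr (_ && _); last exact: relator_merge.
  elim: s => //= i s ->; by rewrite (relator_merge (HP i)).
Qed.

(** Twice the radius at which [growth_ge_tower] with [m = 4 ^ k] finds [2 ^ (4 ^ k)] elements, since
    two words are compared through [rev u ++ v]. *)
Definition radius k : nat := 28 * (3 ^ k * 4 ^ k).

(* The counter [c] moves from [k] to [k.+1] at time [q]: from then on only a finite quotient of the
   [k]-th group, faithful on a ball of radius at least [q], is kept, next to the [k.+1]-st group. *)
Definition stage (c : nat -> nat) p (w : seq gen) : bool :=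
  all (fun q => (c q.+1 != c q) ==> finite_tower (c q) (q + radius (c q)) w) (iota 0 p) &&
  tower (c p) w.

(** A word is judged at the time equal to its length; by [stageS_short] no later stage changes the
    verdict. *)
Definition limit (c : nat -> nat) (w : seq gen) : bool := stage c (size w) w.

Section Limit.
Variables (c : nat -> nat) (cS : forall p, c p.+1 = c p \/ c p.+1 = (c p).+1).

Lemma stage_relator_set p : relator_set (stage c p).
Proof.
apply: (@relator_set_all nat (iota 0 p) (fun q => c q.+1 != c q)
  (fun q => finite_tower (c q) (q + radius (c q)))) => [i|].
- exact: finite_tower_relator_set.
- exact: tower_relator_set.
Qed.

Lemma stage_rec p w : stage c p.+1 w =
  [&& all (fun q => (c q.+1 != c q) ==> finite_tower (c q) (q + radius (c q)) w) (iota 0 p),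
      (c p.+1 != c p) ==> finite_tower (c p) (p + radius (c p)) w & tower (c p.+1) w].
Proof. by rewrite /stage -[p.+1]addn1 iotaD all_cat /= add0n andbT -andbA addn1. Qed.

Lemma stageS p w : stage c p w -> stage c p.+1 w.
Proof.
rewrite stage_rec => /andP[-> H] /=; case: (cS p) => ->; first by rewrite eqxx.
by rewrite tower_finite ?implybT ?towerS.
Qed.

Lemma stageS_short p w : size w <= p -> stage c p.+1 w = stage c p w.
Proof.
move=> Hw; apply/idP/idP => [|/stageS //]; rewrite stage_rec => /and3P[H1 H2 H3].
apply/andP; split=> //; case: (cS p) => E; first by rewrite -E.
move: H2; rewrite E neq_ltn ltnSn orbT /= => /finite_tower_short; apply.
exact: leq_trans Hw (leq_addr _ _).
Qed.

Lemma limit_stage p w : size w <= p -> limit c w = stage c p w.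
Proof.
move=> H; rewrite /limit -(subnK H) addnC; elim: (p - size w) => [|m IH]; first by rewrite addn0.
by rewrite IH addnS stageS_short // leq_addr.
Qed.

Lemma stage_limit p w : stage c p w -> limit c w.
Proof.
move=> H; rewrite (limit_stage (leq_maxr p (size w))) -(subnKC (leq_maxl p (size w))).
by elim: (maxn _ _ - p) => [|m IH]; rewrite ?addn0 // addnS stageS.
Qed.

Lemma limit_relator_set : relator_set (limit c).
Proof.
split=> [|u v w|u x y w C].
- exact: relator_nil (stage_relator_set 0).
(* A time no smaller than the length of any of the words involved lets a single stage judge them
   all. *)
- pose p := size (u ++ v ++ w); rewrite (@limit_stage p v) /p ?size_cat; last by lia.
  move=> Hv; rewrite (@limit_stage p (u ++ v ++ w)) // (@limit_stage p (u ++ w)).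
    by apply: (relator_del (stage_relator_set p)); rewrite /p !size_cat.
  by rewrite /p !size_cat; lia.
- pose p := size (u ++ x :: y :: w); rewrite (@limit_stage p (u ++ x :: y :: w)) //.
  rewrite (@limit_stage p (u ++ merge_gen x y ++ w)).
    exact: relator_merge (stage_relator_set p) _ _ _ _ C.
  by rewrite /p !size_cat /=; case: x {p} C; case: y => /=; lia.
Qed.

Lemma limit_finite_tower q w : c q.+1 != c q -> limit c w ->
  finite_tower (c q) (q + radius (c q)) w.
Proof.
move=> Hq; rewrite (limit_stage (leq_maxr q.+1 (size w))) => /andP[/allP H _].
have := H q; rewrite mem_iota /= Hq => /= -> //.
by rewrite add0n leq_max ltnSn.
Qed.

Lemma limit_tower k p w : (forall q, p <= q -> c q = k) -> limit c w -> tower k w.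
Proof.
move=> Hk; rewrite (limit_stage (leq_maxr p (size w))) => /andP[_].
by rewrite Hk // leq_maxl.
Qed.

End Limit.

(** * Growth conditions with integer parameters *)

Section RealGrowth.
Local Open Scope R_scope.

Lemma INR_leq m k : (m <= k)%N -> INR m <= INR k.
Proof. by move/leP; apply: le_INR. Qed.

Lemma leq_INR m k : INR m <= INR k -> (m <= k)%N.
Proof. by move=> H; apply/leP/INR_le. Qed.

Lemma INR_muln m k : INR (m * k)%N = INR m * INR k.
Proof. by rewrite -multE mult_INR. Qed.

Lemma INR_expn m k : INR (m ^ k)%N = INR m ^ k.
Proof. by elim: k => [|k IH]; rewrite ?expn0 // expnS INR_muln IH. Qed.

Lemma exists_INR_ge r : exists m : nat, r <= INR m.
Proof. by have [m Hm] := INR_unbounded r; exists m; lra. Qed.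

Lemma INR_ge1 x : (0 < x)%N -> 1 <= INR x.
Proof. by move=> H; apply: (INR_leq (m := 1)). Qed.

Variable n : nat.
Implicit Types N : FG n -> bool.

Lemma polynomial_growthP N :
  polynomial_growth N <-> exists m : nat, forall x, (0 < x)%N -> (growth N x <= m * x ^ m)%N.
Proof.
split=> [[C [d [HC [Hd H]]]]|[m H]].
- have [m1 H1] := exists_INR_ge C; have [m2 H2] := exists_INR_ge d.
  exists (maxn m1 m2) => x Hx; apply: leq_INR; apply: Rle_trans (H x Hx) _.
  rewrite INR_muln INR_expn -Rpower_pow; last by have := INR_ge1 Hx; lra.
  have Hm1 := INR_leq (leq_maxl m1 m2); have Hm2 := INR_leq (leq_maxr m1 m2).
  have := INR_ge1 Hx => Hx1.
  apply: Rmult_le_compat; [lra|exact/Rlt_le/exp_pos|lra|].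
  by apply: Rle_Rpower; lra.
(* The successor keeps both constants positive when [m = 0]. *)
- exists (INR m.+1), (INR m.+1); rewrite S_INR; have := pos_INR m => Hm.
  split; first lra; split=> [|x Hx]; first lra.
  have Hx1 := INR_ge1 Hx.
  apply: Rle_trans (INR_leq (H x Hx)) _; rewrite INR_muln INR_expn -Rpower_pow; last lra.
  apply: Rmult_le_compat; [exact: Hm|exact/Rlt_le/exp_pos|lra|].
  by apply: Rle_Rpower; lra.
Qed.

Lemma exponential_growthP N :
  exponential_growth N <->
  exists m : nat, forall x, (0 < x)%N -> (1 + / INR m.+1) ^ x <= INR (growth N x).
Proof.
split=> [[a [Ha H]]|[m H]].
- have [m Hm] := exists_INR_ge (/ (a - 1)); exists m => x Hx.
  apply: Rle_trans (H x Hx); apply: pow_incr.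
  have H0 : 0 < / (a - 1) by apply: Rinv_0_lt_compat; lra.
  have H1 : / (a - 1) <= INR m.+1 by rewrite S_INR; lra.
  have : / INR m.+1 <= / / (a - 1) by apply: Rinv_le_contravar.
  rewrite Rinv_inv => H2; split; last lra.
  have : 0 < / INR m.+1 by apply: Rinv_0_lt_compat; lra.
  by lra.
- exists (1 + / INR m.+1); split=> //.
  have : 0 < / INR m.+1 by apply/Rinv_0_lt_compat/lt_0_INR/ltP.
  by lra.
Qed.

Lemma leq_expn2r (e m k : nat) : (m <= k)%N -> (m ^ e <= k ^ e)%N.
Proof. by case: e => // e; rewrite leq_exp2r. Qed.

Lemma pow_lt_base x y k : 0 < x -> x < y -> (0 < k)%N -> x ^ k < y ^ k.
Proof.
move=> Hx Hxy; elim: k => // -[|k] IH _; first by rewrite !pow_1.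
have := IH isT; have : 0 < x ^ k.+1 by apply: pow_lt.
rewrite -[x ^ k.+2]/(x * x ^ k.+1) -[y ^ k.+2]/(y * y ^ k.+1) => H1 H2.
by apply: Rmult_le_0_lt_compat; lra.
Qed.

Lemma expn_lt_exp4 (A B : nat) : exists k, (A + B * k < 4 ^ k)%N.
Proof.
have H k : (k < 2 ^ k)%N by apply: ltn_expl.
exists (A + B + 1)%N; set k := (A + B + 1)%N.
have -> : (4 ^ k = 2 ^ k * 2 ^ k)%N by rewrite -expnMn.
by have := H k; rewrite /k; nia.
Qed.

(** Since 14 and 12 are at most [2 ^ 4], a bound [m * x ^ m] at these radii is at most 2 to a power
    linear in [k], which [2 ^ (4 ^ k)] overtakes. *)
Lemma not_polynomial_growth N :
  (forall k, 2 ^ (4 ^ k) <= growth N (14 * (3 ^ k * 4 ^ k)))%N -> ~ polynomial_growth N.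
Proof.
move=> H /polynomial_growthP [m Hm].
have [k Hk] := expn_lt_exp4 (m + 4 * m)%N (4 * m)%N.
have Hx : (0 < 14 * (3 ^ k * 4 ^ k))%N by rewrite !muln_gt0 !expn_gt0.
have := leq_trans (H k) (Hm _ Hx); apply/negP; rewrite -ltnNge.
apply: leq_ltn_trans (_ : 2 ^ (m + 4 * m + 4 * m * k) < _)%N; last by rewrite ltn_exp2l.
have -> : (m + 4 * m + 4 * m * k = m + (4 + 4 * k) * m)%N by lia.
rewrite expnD expnM; apply: leq_mul; first exact/ltnW/ltn_expl.
apply: leq_expn2r.
rewrite expnD; apply: leq_mul => //; rewrite -expnMn expnM.
exact: leq_expn2r.
Qed.

Lemma exists_pow_gt a b : 1 < a -> exists m, b < a ^ m.
Proof.
move=> Ha; have [] := Pow_x_infinity a _ (b + 1); first by rewrite Rabs_pos_eq; lra.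
move=> m /(_ m (le_n m)); rewrite Rabs_pos_eq; last by apply: pow_le; lra.
by move=> H; exists m; lra.
Qed.

Lemma mul_exp5_le_exp6 m : exists k, (m * 5 ^ k <= 6 ^ k)%N.
Proof.
(* Bernoulli's inequality for [6 / 5], cleared of denominators. *)
have H k : ((5 + k) * 5 ^ k <= 5 * 6 ^ k)%N by elim: k => // k; rewrite !expnS; nia.
by exists (5 * m)%N; have := H (5 * m)%N; move: (5 ^ _)%N (6 ^ _)%N => A B; nia.
Qed.

(** Letting [z] grow removes [C] and gives [a ^ (6 ^ k) <= b ^ (5 ^ k)] with [b = 8 ^ 12]; letting
    [k] grow then contradicts [1 < a]. *)
Lemma not_exponential_growth N :
  (forall k, exists C, forall z, growth N (6 ^ k * z) <=
    C * 8 ^ (12 * (5 ^ k * z)))%N ->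
  ~ exponential_growth N.
Proof.
move=> H [a [Ha Hexp]]; pose b := INR 8 ^ 12.
have Hb : 0 < b by apply: pow_lt; rewrite /=; lra.
have Hab k : a ^ (6 ^ k)%N <= b ^ (5 ^ k)%N.
  apply: Rnot_lt_le => Hlt; have [C HC] := H k.
  have Hbk : 0 < b ^ (5 ^ k)%N by apply: pow_lt.
  have [m Hm] : exists m, INR C < (a ^ (6 ^ k)%N / b ^ (5 ^ k)%N) ^ m.
    by apply/exists_pow_gt/(Rmult_lt_reg_r _ _ _ Hbk); rewrite /Rdiv Rmult_assoc Rinv_l; lra.
  (* The successor makes the radius [6 ^ k * m.+1] positive. *)
  have {}Hm : INR C < (a ^ (6 ^ k)%N / b ^ (5 ^ k)%N) ^ m.+1.
    apply: Rlt_le_trans Hm _; apply: Rle_pow => //; last exact/leP.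
    by apply/Rlt_le/(Rmult_lt_reg_r _ _ _ Hbk); rewrite /Rdiv Rmult_assoc Rinv_l; lra.
  have Hz : (0 < 6 ^ k * m.+1)%N by rewrite muln_gt0 expn_gt0.
  have := Rle_trans _ _ _ (Hexp _ Hz) (INR_leq (HC m.+1)).
  rewrite INR_muln INR_expn -multE pow_mult pow_mult -/b pow_mult.
  rewrite /Rdiv Rpow_mult_distr pow_inv in Hm.
  have Hbm : 0 < (b ^ (5 ^ k)%N) ^ m.+1 by apply: pow_lt.
  have := Rmult_lt_compat_r _ _ _ Hbm Hm; rewrite Rmult_assoc Rinv_l; lra.
have [m Hm] := exists_pow_gt b Ha; have [k Hk] := mul_exp5_le_exp6 m.
have := Hab k; apply/Rlt_not_le.
apply: Rlt_le_trans (_ : a ^ (m * 5 ^ k)%N <= _); last by apply: Rle_pow; [lra|apply/leP].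
rewrite -multE pow_mult; apply: pow_lt_base => //; by rewrite expn_gt0.
Qed.

End RealGrowth.

(** * Growth type of the limit group *)

Definition limit_predicate n (c : nat -> nat) (u : FG n) : bool :=
  permutational_lift (limit c) (proj1_sig u).

Section LimitGrowth.
Variables (n : nat) (Hn : 1 < n) (c : nat -> nat).
Hypothesis cS : forall p, c p.+1 = c p \/ c p.+1 = (c p).+1.

Lemma limit_word_relator_set : word_relator_set (@permutational_lift n (limit c)).
Proof. exact/lift_word_relator_set/limit_relator_set. Qed.

Lemma limit_normal : is_normal_subgroup (limit_predicate (n := n) c).
Proof. exact/word_relator_normal/limit_word_relator_set. Qed.

Lemma limit_growth_ge2 x : 0 < x -> 2 <= growth (limit_predicate (n := n) c) x.
Proof.
move=> Hx; pose t : letter n := (Ordinal (ltnW Hn), false).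
apply: (@growth_ge_labels n _ _ (@total_shift n) [:: 0%R; 1%R : 'Z_4]) => //.
- exact: limit_word_relator_set.
- by move=> u v _ _ /lift_inv_cat [].
- move=> i; rewrite !inE => /orP[] /eqP ->; [exists [::]|exists [:: t]] => //.
    by rewrite /total_shift big_nil.
  by rewrite /total_shift big_seq1.
Qed.

Lemma limit_exponential_growth k p : (forall q, p <= q -> c q = k) ->
  exponential_growth (limit_predicate (n := n) c).
Proof.
move=> Hk; pose M := (14 * 3 ^ k)%N.
have HM : 0 < M by rewrite muln_gt0 expn_gt0.
have HMR : Rlt 0 (INR (2 * M)) by apply/lt_0_INR/ltP; rewrite muln_gt0.
exists (Rpower 2 (/ INR (2 * M))); split.
  rewrite -(Rpower_O 2); last lra.
  by apply: Rpower_lt; [lra|apply: Rinv_0_lt_compat].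
(* For [x < M] the exponent is 1 and [limit_growth_ge2] suffices; the 2 in [2 * M] absorbs the
   rounding of the division. *)
move=> x Hx; pose m := maxn 1 (x %/ M).
have Hxm : x <= 2 * M * m.
  have := ltn_ceil x HM; rewrite /m; move: (x %/ M) => d; case: d => [|d]; last by nia.
  by rewrite maxn0; nia.
apply: (Rle_trans _ (pow (Rpower 2 (/ INR (2 * M))) (2 * M * m))).
  apply: Rle_pow; last exact/leP.
  rewrite -(Rpower_O 2); last lra.
  by apply/Rlt_le/Rpower_lt; [lra|apply: Rinv_0_lt_compat].
have E : pow (Rpower 2 (/ INR (2 * M))) (2 * M) = INR 2.
  by rewrite -Rpower_pow ?Rpower_mult ?Rinv_l ?Rpower_1 //=; [lra|lra|exact: exp_pos].
rewrite -{1}multE pow_mult E -INR_expn; apply: INR_leq.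
rewrite /m; case: (x %/ M) (leq_trunc_div x M) => [|d] Hd; first exact: limit_growth_ge2.
rewrite (maxn_idPr _) //; apply: (growth_ge_tower Hn (k := k)).
- exact: limit_word_relator_set.
- move=> u v _ _ /lift_inv_cat [_ /(_ 0%R)].
  exact: (limit_tower cS Hk).
- by rewrite mulnA mulnC.
Qed.

Lemma limit_intermediate_growth :
  (forall k, exists q, c q = k /\ c q.+1 != c q) ->
  intermediate_growth (limit_predicate (n := n) c).
Proof.
move=> H; split.
- apply: not_polynomial_growth => k; have [q [Hq Hq1]] := H k.
  apply: (growth_ge_tower Hn (k := k)) => //; first exact: limit_word_relator_set.
  move=> u v Hu Hv /lift_inv_cat [_ /(_ 0%R)] /(limit_finite_tower cS Hq1).
  rewrite Hq; apply: finite_tower_short; rewrite size_cat size_rev /radius.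
  by have := size_trace 0%R u; have := size_trace 0%R v; lia.
- apply: not_exponential_growth => k; have [q [Hq _]] := H k.
  apply: growth_le_tower; last 1 first.
  (* At time [q] the stage is [tower k] cut down by finitely many conditions of finite index. *)
  + move=> w Hw Ht; apply: (stage_limit cS (p := q)).
    by rewrite /stage Hq Ht andbT; exact: Hw.
  + by apply: finite_index_all => i; apply: finite_tower_index.
  + exact: limit_relator_set.
Qed.

End LimitGrowth.

(** * Dependence on finite data, and membership in [Pi02] *)

Lemma limit_ext (c c' : nat -> nat) p w :
  (forall q, q <= p -> c q = c' q) -> size w <= p -> limit c w = limit c' w.
Proof.
move=> H Hw; rewrite /limit /stage H //; congr (_ && _).
apply: eq_in_all => q; rewrite mem_iota add0n => /andP[_ Hq].
by rewrite !H //; apply: leq_trans Hw => //; apply: ltnW.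
Qed.

Lemma limit_predicate_ext n (c c' : nat -> nat) p (u : FG n) :
  (forall q, q <= p -> c q = c' q) -> size (proj1_sig u) <= p ->
  limit_predicate c u = limit_predicate c' u.
Proof.
move=> H Hu; rewrite /limit_predicate /permutational_lift; congr (_ && _).
apply: eq_forallb => i; apply: limit_ext H _; exact: leq_trans (size_trace _ _) Hu.
Qed.

Lemma growth_ext n (N N' : FG n -> bool) x :
  (forall u v, List.In u (ball n x) -> List.In v (ball n x) ->
     N (FGmul (FGinv u) v) = N' (FGmul (FGinv u) v)) ->
  growth N x = growth N' x.
Proof.
rewrite /growth; elim: (ball n x) => //= a s IH H; rewrite IH; last first.
  by move=> u v Hu Hv; apply: H; right.
congr (_ + _); congr (if _ then _ else _).
have : forall v, List.In v s -> N (FGmul (FGinv a) v) = N' (FGmul (FGinv a) v).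
  by move=> v Hv; apply: H; [left|right].
elim: s {IH H} => //= b s IH H; rewrite IH => [|v Hv]; last by apply: H; right.
by rewrite H //; left.
Qed.

Lemma In_allpairs (S T U : Type) (f : S -> T -> U) s t a b :
  List.In a s -> List.In b t -> List.In (f a b) [seq f x y | x <- s, y <- t].
Proof.
move=> Ha Hb; elim: s Ha => //= x s IH [->|Ha]; apply: List.in_or_app.
  by left; apply: List.in_map.
by right; apply: IH.
Qed.

(** The value of the growth function at [x] depends on finitely many memberships, so the failure of
    the condition at some [x] is open. *)
Lemma growth_closed n (rel : nat -> nat -> Prop) :
  closed_in (@Gn_open n) (fun N => forall x, 0 < x -> rel x (growth (proj1_sig N) x)).
Proof.
exists (fun N => ~ forall x, 0 < x -> rel x (growth N x)); split=> // N HN.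
have [x Hx] := not_all_ex_not _ _ HN.
exists [seq FGmul (FGinv u) v | u <- ball n x, v <- ball n x] => N' H HN'; apply: Hx => Hx.
rewrite -(growth_ext (N := N')) => [|u v Hu Hv]; first exact: HN'.
by apply: H; apply: (In_allpairs (fun u v => FGmul (FGinv u) v)).
Qed.

Lemma intermediate_growth_Pi02 n :
  Pi02 (@Gn_open n) (fun N => intermediate_growth (proj1_sig N)).
Proof.
exists (fun N => polynomial_growth (proj1_sig N) \/ exponential_growth (proj1_sig N)).
split; last by move=> N; split=> [[H1 H2] []|H] //; split=> H'; apply: H; [left|right].
(* Odd indices enumerate the polynomial bounds, even ones the exponential bounds. *)
pose rel (k x g : nat) :=
  if odd k then (g <= k./2 * x ^ k./2 : Prop)
  else Rle (pow (Rplus 1 (Rinv (INR k./2.+1))) x) (INR g).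
exists (fun k N => forall x, 0 < x -> rel k x (growth (proj1_sig N) x)).
split=> [k|N]; first exact: growth_closed.
split=> [[/polynomial_growthP|/exponential_growthP] [m H]|[k]].
- by exists m.*2.+1 => x /H; rewrite /rel /= odd_double uphalf_double.
- by exists m.*2 => x /H; rewrite /rel odd_double doubleK.
- rewrite /rel; case: (odd k) => H;
    [left; apply/polynomial_growthP|right; apply/exponential_growthP]; by exists k./2.
Qed.

(** * Clopen covers in zero-dimensional Polish spaces *)

Section ZeroDimensional.
Variables (Y : Type) (d : Y -> Y -> R).

Definition locally_constant (T : Type) (f : Y -> T) : Prop :=
  forall y, exists eps, Rlt 0 eps /\ forall z, Rlt (d y z) eps -> f z = f y.

Lemma locally_constant2 (T1 T2 T : Type) (g : T1 -> T2 -> T) f1 f2 :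
  locally_constant f1 -> locally_constant f2 -> locally_constant (fun y => g (f1 y) (f2 y)).
Proof.
move=> H1 H2 y; have [e1 [He1 {}H1]] := H1 y; have [e2 [He2 {}H2]] := H2 y.
exists (Rmin e1 e2); split=> [|z Hz]; first exact: Rmin_glb_lt.
rewrite H1 ?H2 //; first exact: Rlt_le_trans Hz (Rmin_r _ _).
exact: Rlt_le_trans Hz (Rmin_l _ _).
Qed.

Lemma clopen_indicator (V : Y -> Prop) :
  metric_open d V -> closed_in (metric_open d) V ->
  exists v : Y -> bool, locally_constant v /\ forall y, v y <-> V y.
Proof.
move=> Vo Vc; exists (fun y => if excluded_middle_informative (V y) then true else false).
split=> [y|y]; last by case: excluded_middle_informative.
case: (excluded_middle_informative (V y)) => Hy.
- have [e [He H]] := Vo y Hy; exists e; split=> // z /H Hz.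
  by case: excluded_middle_informative.
- have [e [He H]] := Vc y Hy; exists e; split=> // z /H Hz.
  by case: excluded_middle_informative.
Qed.

Hypothesis HY : zero_dim_polish d.

(** For each point [D k] and radius [1 / (m + 1)], one clopen subset of [U] containing that ball is
    chosen if there is any, and the empty set or another clopen subset of [U] otherwise. *)
Lemma open_clopen_cover (U : Y -> Prop) : metric_open d U ->
  exists v : nat -> Y -> bool, (forall i, locally_constant (v i)) /\
    forall y, U y <-> exists i, v i y.
Proof.
move: HY => [[_ [_ [dC dT]]] [_ [[D HD] HZ]]] HU.
pose good (v : Y -> bool) := locally_constant v /\ forall y, v y -> U y.
pose covers (i : nat) (v : Y -> bool) := forall (k m : nat) z, unpickle i = Some (k, m) ->
  D k = Some z -> forall y, Rlt (d y z) (Rinv (INR m.+1)) -> v y.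
have Hex i : exists v, good v /\ ((exists v', good v' /\ covers i v') -> covers i v).
  case: (classic (exists v', good v' /\ covers i v')) => [[v' [H1 H2]]|H]; first by exists v'.
  exists (fun _ => false); split=> //; split=> // y.
  by exists R1; split=> //; exact: Rlt_0_1.
pose v i := proj1_sig (constructive_indefinite_description _ (Hex i)).
have Hv i : good (v i) /\ ((exists v', good v' /\ covers i v') -> covers i (v i)).
  by rewrite /v; case: constructive_indefinite_description.
exists v; split=> [i|y]; first by case: (Hv i) => -[].
split=> [Uy|[i]]; last by case: (Hv i) => -[_ H] _; apply: H.
have [V [Vo [Vc [Vy VU]]]] := HZ U y HU Uy.
have [w [Hw HwV]] := clopen_indicator Vo Vc.
have [e [He HVe]] := Vo y Vy.
have [m Hm] := exists_INR_ge (Rmult 2 (Rinv e)).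
have Hm0 : Rlt 0 (Rinv (INR m.+1)) by apply/Rinv_0_lt_compat/lt_0_INR/ltP.
(* A radius below [e / 2] keeps the ball around [z], which contains [y], inside the [e]-ball around
   [y]. *)
have Hme : Rlt (Rinv (INR m.+1)) (Rmult e (Rinv 2)).
  have He' := Rinv_0_lt_compat _ He.
  rewrite -[e in Rmult e _]Rinv_inv -Rinv_mult.
  apply: Rinv_lt_contravar; first apply: Rmult_lt_0_compat; try lra.
    by apply/lt_0_INR/ltP.
  by rewrite S_INR; lra.
have [k [z [Hk Hz]]] := HD y _ Hm0.
exists (pickle (k, m)); case: (Hv (pickle (k, m))) => _ H.
apply: (H _ k m z) => //; last by rewrite pickleK.
exists w; split=> [|k' m' z']; first by split=> // x /HwV /VU.
rewrite pickleK => -[<- <-]; rewrite Hk => -[<-] x Hx.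
apply/HwV/HVe; apply: Rle_lt_trans (dT y z x) _; rewrite (dC z x); lra.
Qed.

End ZeroDimensional.

(** * Counters and their boundedness *)

Section Counter.
Variable v : nat -> nat -> bool.

Fixpoint counter p : nat :=
  if p is p'.+1 then (if v (counter p') p' then (counter p').+1 else counter p') else 0.

Lemma counter_step p : counter p.+1 = counter p \/ counter p.+1 = (counter p).+1.
Proof. by rewrite /=; case: ifP; [right|left]. Qed.

Lemma counter_unbounded : (forall k, exists m, forall p, m <= p -> v k p) ->
  forall k, exists q, counter q = k /\ counter q.+1 != counter q.
Proof.
(* Induction on the time left until [m]: the counter waits at [k] until some test [v k] succeeds. *)
move=> H; have next k q : counter q = k -> exists q', counter q' = k /\ v k q'.
  have [m Hm] := H k; elim: {q}(m - q) {-2}q (leqnn (m - q)) => [|b IH] q Hb Hq.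
    by exists q; split=> //; apply: Hm; lia.
  case E: (v k q); first by exists q.
  by apply: (IH q.+1); [lia|rewrite /= Hq E].
elim=> [|k [q [Hq]]].
  by have [q [Hq E]] := next 0 0 erefl; exists q; rewrite /= Hq E.
rewrite /=; case: ifP => E; last by rewrite eqxx.
move=> _; have [q' [Hq' E']] : exists q', counter q' = k.+1 /\ v k.+1 q'.
  by apply: (next _ q.+1); rewrite /= E Hq.
by exists q'; rewrite /= Hq' E' neq_ltn ltnSn orbT.
Qed.

Lemma counter_mono p q : p <= q -> counter p <= counter q.
Proof.
move=> /subnK <-; elim: (q - p) => // m IH; apply: leq_trans IH _.
by rewrite addSn; case: (counter_step (m + p)) => ->.
Qed.

(** The counter cannot pass [k], and being monotone it stabilises; the induction is on the room
    [k - counter p] left. *)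
Lemma counter_bounded k : (forall p, v k p = false) ->
  exists k' p, forall q, p <= q -> counter q = k'.
Proof.
move=> Hk; have Hb q : counter q <= k.
  elim: q => //= q IH; case: ifP => // E; rewrite ltn_neqAle IH andbT.
  by apply/eqP=> Eq; rewrite Eq Hk in E.
suff H b p : k - counter p <= b -> exists k' p, forall q, p <= q -> counter q = k'.
  exact: (H (k - counter 0) 0).
elim: b p => [|b IH] p Hp.
  exists k, p => q Hq; apply/eqP; rewrite eqn_leq Hb.
  by have := counter_mono Hq; have := Hb p; lia.
case: (classic (forall q, p <= q -> counter q = counter p)) => H; first by exists (counter p), p.
have [q Hq] := not_all_ex_not _ _ H; have [Hpq Hne] := imply_to_and _ _ Hq.
by apply: (IH q); have := counter_mono Hpq; have := Hb q; lia.
Qed.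

End Counter.

(** * The continuous reduction *)

Theorem mainTheorem4 (n : nat) (Hn : (1 < n)%N) :
  Pi02_complete (@Gn_open n)
    (fun N : Gn n => intermediate_growth (proj1_sig N)).
Proof.
split; first exact: intermediate_growth_Pi02.
move=> Y d HY B [B' [[F [HF HB']] HB]].
have Hcover k := open_clopen_cover HY (HF k).
pose w k := proj1_sig (constructive_indefinite_description _ (Hcover k)).
have [wc wF] : (forall k i, locally_constant d (w k i)) /\
    forall k y, ~ F k y <-> exists i, w k i y.
  by split=> k; rewrite /w; case: constructive_indefinite_description => ? [].
(* The test succeeds once one of the first [p] clopen pieces of the complement of [F k] contains
   [y]; thus the counter leaves every [k] exactly when [y] avoids all [F k]. *)
pose v y k p := has (fun i => w k i y) (iota 0 p).
have vc k p : locally_constant d (fun y => v y k p).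
  rewrite /v; elim: (iota 0 p) => [|i s IH] /=.
    by move=> y; exists R1; split=> //; exact: Rlt_0_1.
  exact: (locally_constant2 orb (wc k i) IH).
pose f y : Gn n := exist _ (limit_predicate (counter (v y)))
  (limit_normal n (@counter_step (v y))).
exists f; split=> [U [O [HO HUO]] y /HUO Oy|y].
- have [s Hs] := HO _ Oy.
  have [p Hp] : exists p, forall u, List.In u s -> size (proj1_sig u) <= p.
    elim: s {Hs} => [|u s [p Hp]]; first by exists 0.
    exists (maxn p (size (proj1_sig u))) => u' [<-|/Hp H]; first exact: leq_maxr.
    exact: leq_trans H (leq_maxl _ _).
  have Hc q : locally_constant d (fun y => counter (v y) q).
    elim: q => [|q IH] /=; first by move=> x; exists R1; split=> //; exact: Rlt_0_1.
    (* Near [x] the value at time [q] is fixed, so only one test has to be locally constant as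
       well. *)
    move=> x; have [e1 [He1 H1]] := IH x.
    have [e2 [He2 H2]] := vc (counter (v x) q) q x.
    exists (Rmin e1 e2); split=> [|z Hz]; first exact: Rmin_glb_lt.
    rewrite H1 ?H2 //; first exact: Rlt_le_trans Hz (Rmin_r _ _).
    exact: Rlt_le_trans Hz (Rmin_l _ _).
  have [e [He H]] : exists e, Rlt 0 e /\
      forall z, Rlt (d y z) e -> forall q, q <= p -> counter (v z) q = counter (v y) q.
    elim: (p) => [|p' [e1 [He1 H1]]].
      by exists R1; split=> [|z _ [|q]] //; exact: Rlt_0_1.
    have [e2 [He2 H2]] := Hc p'.+1 y.
    exists (Rmin e1 e2); split=> [|z Hz q]; first exact: Rmin_glb_lt.
    rewrite leq_eqVlt ltnS => /orP[/eqP ->|Hq].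
      by apply: H2; apply: Rlt_le_trans Hz (Rmin_r _ _).
    by apply: H1 => //; apply: Rlt_le_trans Hz (Rmin_l _ _).
  exists e; split=> // z Hz; apply/HUO/Hs => u Hu /=.
  by apply: (limit_predicate_ext (p := p)); [apply: H | apply: Hp].
- split=> [By|HI].
    apply: (limit_intermediate_growth Hn (@counter_step (v y))).
    apply: counter_unbounded => k; move/HB: By => HB'y.
    have /wF [i Hi] : ~ F k y by move=> Fk; apply: HB'y; apply/HB'; exists k.
    exists i.+1 => p Hp; apply/hasP; exists i => //.
    by rewrite mem_iota.
  apply/HB => /HB' [k Fk]; case: HI => _; apply.
  have [k' [p Hp]] : exists k' p, forall q, p <= q -> counter (v y) q = k'.
    apply: (@counter_bounded _ k) => p; apply/hasP=> -[i _ Hi].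
    by have /wF : exists i, w k i y by exists i.
  exact: (limit_exponential_growth Hn (@counter_step (v y)) Hp).
Qed.
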